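(* Let $n\ge 3$ and $t,q\in\mathbb{C}^\times$. The Krammer representation $k_n^{(t,q)}$ of the braid group $B_n$ is equivalent to the quantization $\big[S^2(\rho_n^{(t)})\big]_q$ of the symmetric square of the reduced Burau representation $\rho_n^{(t)}$. That is, there is a linear isomorphism $C$ from $S^2(\mathbb{C}^{n-1})$ onto the representation space of $k_n^{(t,q)}$ such that $$C\,\big[S^2(\rho_n^{(t)}(\sigma_k))\big]_q\,C^{-1}=k_n^{(t,q)}(\sigma_k)\qquad\text{for all }1\le k\le n-1 .$$
   Context: $B_n$ is the braid group with standard generators $\sigma_1,\dots,\sigma_{n-1}$ (relations $\sigma_i\sigma_{i+1}\sigma_i=\sigma_{i+1}\sigma_i\sigma_{i+1}$, and $\sigma_i\sigma_j=\sigma_j\sigma_i$ for $|i-j|\ge 2$). **Krammer representation.** $k_n^{(t,q)}$ is the representation of $B_n$ on the vector space with basis $\{F_{j,k}:1\le j<k\le n\}$ given by $$\sigma_i(F_{j,k})=\begin{cases}F_{j,k}& i\notin\{j-1,j,k-1,k\},\\ tF_{i,k}+t(t-1)F_{i,j}+(1-t)F_{j,k}& i=j-1,\\ F_{j+1,k}& i=j\ne k-1,\\ tF_{j,i}+(1-t)F_{j,k}+t(t-1)q\,F_{i,k}& i=k-1\ne j,\\ F_{j,k+1}& i=k,\\ q t^2F_{j,k}& i=j=k-1.\end{cases}$$ **Reduced Burau representation.** Let $m=n-1$, let $e_1,\dots,e_m$ be the standard basis of $\mathbb{C}^m$ and $E_{ij}$ the matrix units. Let $d_k$ be the diagonal matrix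 with entry $-t$ in position $(k,k)$ and all other diagonal entries equal to $1$ (so $d_k=\exp(sE_{kk})$ with $s=\ln(-t)$). Then $\rho_n^{(t)}:B_n\to GL_m(\mathbb{C})$ is $$\sigma_1\mapsto d_1\exp(-E_{12}),\qquad \sigma_k\mapsto \exp(E_{k,k-1})\,d_k\,\exp(-E_{k,k+1})\ (2\le k\le m-1),\qquad \sigma_m\mapsto\exp(E_{m,m-1})\,d_m .$$ **Symmetric square.** $S^2(\mathbb{C}^m)$ has basis $e^s_{ii}=e_i\otimes e_i$ and $e^s_{ij}=e^s_{ji}=e_i\otimes e_j+e_j\otimes e_i$ ($i\neq j$); $S^2(A)$ is the restriction of $A\otimes A$ to $S^2(\mathbb{C}^m)$. **Quantization.** For $c\in\{1,-1\}$ and $i\ne j$, the operator $[S^2(\exp(cE_{ij}))]_q$ on $S^2(\mathbb{C}^m)$ is obtained from $S^2(\exp(cE_{ij}))$ by replacing, in its matrix in the basis $(e^s_{rs})$, the binomial coefficient $2$ by the $q$-binomial coefficient $\binom{2}{1}_q=1+q$. Explicitly: $$e^s_{jj}\mapsto e^s_{jj}+c\,e^s_{ij}+e^s_{ii},\quad e^s_{ij}\mapsto e^s_{ij}+c(1+q)e^s_{ii},\quad e^s_{jr}\mapsto e^s_{jr}+c\,e^s_{ir}\ (r\ne i,j),$$ and all other basis vectors are fixed. Let $D_k(q)$ be the diagonal operator with $D_k(q)e^s_{kk}=q\,e^s_{kk}$ and $D_k(q)e^s_{rs}=e^s_{rs}$ for $(r,s)\neq(k,k)$. The quantization of $S^2(\rho_n^{(t)})$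 is defined on generators by $$[S^2(\rho_n^{(t)}(\sigma_1))]_q=S^2(d_1)\,[S^2(\exp(-E_{12}))]_q\,D_1(q),$$ $$[S^2(\rho_n^{(t)}(\sigma_k))]_q=[S^2(\exp(E_{k,k-1}))]_q\,D_k(q)\,S^2(d_k)\,[S^2(\exp(-E_{k,k+1}))]_q\qquad(2\le k\le m-1),$$ $$[S^2(\rho_n^{(t)}(\sigma_m))]_q=[S^2(\exp(E_{m,m-1}))]_q\,D_m(q)\,S^2(d_m).$$
   Formalization: For 2≤k≤m-1 the factor D_k(q) is placed rightmost, after [S^2(exp(-E_{k,k+1}))]_q, instead of left of S^2(d_k); with the printed order the braid relation of σ_1, σ_2 fails for all n≥4, q≠1. For n=3 or q=1 nothing changes. *)

(* Defs.v *)
From HB Require Import structures.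
From mathcomp Require Import all_boot all_order all_algebra.
From mathcomp Require Import mxtens ring.

Set Implicit Arguments.
Unset Strict Implicit.
Unset Printing Implicit Defensive.

Import GRing.Theory.
Local Open Scope ring_scope.

(* Indices are 0-based throughout: [k : 'I_n.-1] stands for sigma_(k+1), the
   basis vectors of F^m are e_0, ..., e_(m-1), and F_{j,k} has 0 <= j < k < n.
   The formulas only involve differences of indices, so they are unchanged. *)

Section SymmetricSquare.
Variables (F : fieldType) (m : nat).
Implicit Types (i j r s : 'I_m) (A B : 'M[F]_m).

Definition evec i : 'cV[F]_m := delta_mx i 0.

Definition sym_tens i j : 'cV[F]_(m * m) :=
  if i == j then evec i *t evec i
  else evec i *t evec j + evec j *t evec i.

Definition sym2_space : {vspace 'cV[F]_(m * m)} :=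
  <<[seq sym_tens p.1 p.2 | p : 'I_m * 'I_m]>>%VS.

Definition sym2 : vectType F := subvs_of sym2_space.

Definition es i j : sym2 := vsproj sym2_space (sym_tens i j).

(* [S2 A] is the restriction of A (x) A: [S2E] below shows that the projection
   [vsproj] only changes the type. *)
Definition S2 A : 'End(sym2) :=
  linfun (vsproj sym2_space \o mulmx (A *t A) \o vsval).

(* The coordinate of [v] on e^s_ij is its coefficient on e_i (x) e_j. *)
Definition sym_coord (v : sym2) i j : F := vsval v (mxtens_index (i, j)) 0.

(* The linear operator with e^s_ij |-> f i j for i <= j (the values of f for
   i > j are not used). *)
Definition sym_ext_fun (f : 'I_m -> 'I_m -> sym2) (v : sym2) : sym2 :=
  \sum_(i < m) \sum_(j < m | (i <= j)%N) sym_coord v i j *: f i j.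

Definition sym_ext (f : 'I_m -> 'I_m -> sym2) : 'End(sym2) :=
  linfun (sym_ext_fun f).

Lemma sym_tensC i j : sym_tens i j = sym_tens j i.
Proof. by rewrite /sym_tens eq_sym; case: eqP => [->|_] //; rewrite addrC. Qed.

Lemma sym_tens_mem i j : sym_tens i j \in sym2_space.
Proof. by apply: memv_span; apply/mapP; exists (i, j); rewrite ?mem_enum. Qed.

Lemma val_es i j : vsval (es i j) = sym_tens i j.
Proof. by rewrite /es vsprojK ?sym_tens_mem. Qed.

Lemma esC i j : es i j = es j i.
Proof. by rewrite /es sym_tensC. Qed.

Lemma evec_tensE i j r s :
  (evec i *t evec j) (mxtens_index (r, s)) 0 = ((r == i) && (s == j))%:R.
Proof.
rewrite mxE mxtens_indexK !mxE /= -natrM mulnb.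
by rewrite !ord1 !eqxx !andbT.
Qed.

Lemma sym_tensE i j r s : sym_tens i j (mxtens_index (r, s)) 0 =
  (((r == i) && (s == j)) || ((r == j) && (s == i)))%:R.
Proof.
rewrite /sym_tens; case: (eqVneq i j) => [<-|nij].
  by rewrite evec_tensE orbb.
rewrite mxE !evec_tensE -natrD; congr (_%:R).
have : ~~ [&& r == i, s == j, r == j & s == i].
  by apply: contra nij => /and4P[/eqP <- _ /eqP <- _].
by do 4!case: (_ == _).
Qed.

Lemma sym_coord_es i j r s : sym_coord (es i j) r s =
  (((r == i) && (s == j)) || ((r == j) && (s == i)))%:R.
Proof. by rewrite /sym_coord val_es sym_tensE. Qed.

Lemma sym_pick (V : lmodType F) (f : 'I_m -> 'I_m -> V) i j : (i <= j)%N ->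
  \sum_(r < m) \sum_(s < m | (r <= s)%N)
    (((r == i) && (s == j)) || ((r == j) && (s == i)))%:R *: f r s = f i j.
Proof.
move=> lij; rewrite (bigD1 i) //= (bigD1 j) //= !eqxx /= scale1r.
rewrite big1 ?addr0 => [|s /andP[lis njs]]; last first.
  rewrite (negbTE njs) /=.
  case: (eqVneq i j) => [eij|]; last by rewrite scale0r.
  by rewrite eij (negbTE njs) scale0r.
rewrite big1 ?addr0 // => r nri; rewrite big1 // => s lrs.
rewrite (negbTE nri) /=.
case: (eqVneq r j) => [erj|] /=; last by rewrite scale0r.
case: (eqVneq s i) => [esi|]; last by rewrite scale0r.
have: r = i by apply/val_inj/eqP; rewrite eqn_leq {2}erj lij -{1}esi lrs.
by move/eqP; rewrite (negbTE nri).
Qed.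

Lemma sym2_spaceP (w : 'cV[F]_(m * m)) : reflect
  (forall r s, w (mxtens_index (r, s)) 0 = w (mxtens_index (s, r)) 0)
  (w \in sym2_space).
Proof.
apply: (iffP idP) => [ws r s|sw].
  have /coord_span -> : w \in <<in_tuple
    [seq sym_tens p.1 p.2 | p : 'I_m * 'I_m]>>%VS by [].
  rewrite !summxE; apply: eq_bigr => k _; rewrite 2!mxE; congr (_ * _).
  have /mapP[p _ ->] : (in_tuple [seq sym_tens p.1 p.2 | p : 'I_m * 'I_m])`_k
     \in [seq sym_tens p.1 p.2 | p : 'I_m * 'I_m] by rewrite mem_nth.
  by rewrite !sym_tensE; do 4!case: (_ == _).
suff -> : w = \sum_(i < m) \sum_(j < m | (i <= j)%N)
    w (mxtens_index (i, j)) 0 *: sym_tens i j.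
  by do 2!apply: memv_suml => ? _; rewrite memvZ ?sym_tens_mem.
apply/colP => k; rewrite -[k]mxtens_unindexK.
case: (mxtens_unindex k) => {k} r s.
rewrite summxE.
transitivity (\sum_(i < m) \sum_(j < m | (i <= j)%N)
  (((i == r) && (j == s)) || ((i == s) && (j == r)))%:R *:
     (w (mxtens_index (i, j)) 0 : F^o)).
  have [lrs|/ltnW lsr] := leqP r s; first by rewrite sym_pick.
  rewrite sw -[LHS](sym_pick (fun i j => w (mxtens_index (i, j)) 0 : F^o)) //.
  by do 2!apply: eq_bigr => ? _; rewrite orbC.
apply: eq_bigr => i _; rewrite summxE; apply: eq_bigr => j _.
rewrite mxE sym_tensE mulrC /GRing.scale /=; congr (_%:R * _).
by rewrite ![r == _]eq_sym ![s == _]eq_sym; do 4!case: (_ == _).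
Qed.

Lemma sym2E (v : sym2) :
  v = \sum_(i < m) \sum_(j < m | (i <= j)%N) sym_coord v i j *: es i j.
Proof.
apply/val_inj; rewrite /= linear_sum; apply/colP => k.
rewrite -[k]mxtens_unindexK; case: (mxtens_unindex k) => {k} r s.
have /sym2_spaceP sw := subvsP v.
rewrite summxE.
transitivity (\sum_(i < m) \sum_(j < m | (i <= j)%N)
  (((i == r) && (j == s)) || ((i == s) && (j == r)))%:R *:
     (sym_coord v i j : F^o)).
  have [lrs|/ltnW lsr] := leqP r s; first by rewrite sym_pick.
  rewrite sw -[LHS](sym_pick (fun i j => sym_coord v i j : F^o)) //.
  by do 2!apply: eq_bigr => ? _; rewrite orbC.
apply: eq_bigr => i _; rewrite linear_sum summxE; apply: eq_bigr => j _.
rewrite linearZ /= val_es mxE sym_tensE mulrC /GRing.scale /=; congr (_%:R * _).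
by rewrite ![r == _]eq_sym ![s == _]eq_sym; do 4!case: (_ == _).
Qed.

Lemma sym2_ext (f g : 'End(sym2)) :
  (forall i j, (i <= j)%N -> f (es i j) = g (es i j)) -> f = g.
Proof.
move=> efg; apply/lfunP => v; rewrite [v]sym2E !linear_sum.
apply: eq_bigr => i _; rewrite !linear_sum; apply: eq_bigr => j lij.
by rewrite !linearZ /= efg.
Qed.

Lemma sym_ext_fun_is_linear f : linear (sym_ext_fun f).
Proof.
move=> a u v; rewrite /sym_ext_fun scaler_sumr -big_split /=.
apply: eq_bigr => i _; rewrite scaler_sumr -big_split /=.
by apply: eq_bigr => j _; rewrite /sym_coord linearP !mxE scalerDl scalerA.
Qed.

HB.instance Definition _ f := GRing.isLinear.Build F sym2 sym2 _
  (sym_ext_fun f) (sym_ext_fun_is_linear f).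

Lemma sym_extE f i j : (i <= j)%N -> sym_ext f (es i j) = f i j.
Proof.
move=> lij; rewrite /sym_ext lfunE /= /sym_ext_fun -[RHS](sym_pick f lij).
by do 2!apply: eq_bigr => ? _; rewrite sym_coord_es.
Qed.

Lemma tens_coord (u v : 'cV[F]_m) r s :
  (u *t v) (mxtens_index (r, s)) 0 = u r 0 * v s 0.
Proof. by rewrite mxE mxtens_indexK /= !ord1. Qed.

Lemma tens_swap_mem (u v : 'cV[F]_m) : u *t v + v *t u \in sym2_space.
Proof.
apply/sym2_spaceP => r s; rewrite !mxE !mxtens_indexK /= !ord1.
by rewrite addrC; congr (_ + _); rewrite mulrC.
Qed.

Lemma tens_diag_mem (u : 'cV[F]_m) : u *t u \in sym2_space.
Proof. by apply/sym2_spaceP => r s; rewrite !tens_coord mulrC. Qed.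

Lemma mul_tens A B (u v : 'cV[F]_m) :
  (A *t B) *m (u *t v : 'cV[F]_(m * m)) = (A *m u) *t (B *m v).
Proof. exact: (@tensmx_mul _ _ _ _ _ 1 1 A B u v). Qed.

Lemma mul_tens_mem A w : w \in sym2_space -> (A *t A) *m w \in sym2_space.
Proof.
move=> ws; have <- : vsval (vsproj sym2_space w) = w by rewrite vsprojK.
rewrite [vsproj _ _]sym2E linear_sum mulmx_sumr; apply: memv_suml => i _.
rewrite linear_sum mulmx_sumr; apply: memv_suml => j _.
rewrite linearZ /= memvZ // val_es /sym_tens.
by case: eqP => _; rewrite ?mulmxDr !mul_tens ?tens_diag_mem ?tens_swap_mem.
Qed.

Lemma S2E A v : vsval (S2 A v) = (A *t A) *m vsval v.
Proof. by rewrite /S2 lfunE /= vsprojK // mul_tens_mem ?subvsP. Qed.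

Lemma S2M A B : S2 (A *m B) = (S2 A \o S2 B)%VF.
Proof.
by apply/lfunP => v; apply/val_inj; rewrite /= comp_lfunE !S2E -tensmx_mul mulmxA.
Qed.


(* exp(c E_ij) for i != j: the series stops because E_ij ^ 2 = 0. *)
Definition expE (c : F) i j : 'M[F]_m := 1%:M + c *: delta_mx i j.

(* [S^2(exp(c E_ij))]_q, for i != j and c = 1 or c = -1. *)
Definition qexpS2 (q c : F) i j : 'End(sym2) :=
  sym_ext (fun r s =>
    if (r == j) && (s == j) then es j j + c *: es i j + es i i
    else if ((r == i) && (s == j)) || ((r == j) && (s == i))
      then es i j + (c * (1 + q)) *: es i i
    else if r == j then es j s + c *: es i s
    else if s == j then es j r + c *: es i r
    else es r s).

Lemma expE_evec c i j r :
  expE c i j *m evec r = evec r + (c * (r == j)%:R) *: evec i.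
Proof.
rewrite mulmxDl mul1mx -scalemxAl /evec mul_delta_mx_cond eq_sym -scalerMnr.
by case: (r == j); rewrite ?mulr1 ?mulr0 ?scale0r.
Qed.

Lemma qexpS2_1 c i j : i != j -> c ^+ 2 = 1 ->
  qexpS2 1 c i j = S2 (expE c i j).
Proof.
move=> nij c2; apply: sym2_ext => r s lrs; rewrite sym_extE //.
apply/val_inj => /=; rewrite S2E val_es.
have -> : (expE c i j *t expE c i j) *m sym_tens r s =
    let f x := evec x + (c * (x == j)%:R) *: evec i in
    if r == s then f r *t f r else f r *t f s + f s *t f r.
  by rewrite /sym_tens; case: eqP => _ /=; rewrite ?mulmxDr !mul_tens !expE_evec.
rewrite /=.
have nji : j != i by rewrite eq_sym.
case: (eqVneq r j) => [->|nrj]; case: (eqVneq s j) => [->|nsj] /=;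
  rewrite ?eqxx ?(negbTE nij) ?(negbTE nji) ?andbF ?orbF ?mulr1 ?mulr0 ?scale0r ?addr0 /=.
- rewrite !val_es /sym_tens !eqxx (negbTE nij).
  move: (evec i) (evec j) => x y; apply/matrixP => a b; rewrite !mxE.
  by ring: c2.
- case: (eqVneq s i) => [->|nsi] /=; rewrite !val_es /sym_tens.
    rewrite (negbTE nij) eqxx.
    by move: (evec i) (evec j) => x y; apply/matrixP => a b; rewrite !mxE; ring.
  rewrite [j == s]eq_sym (negbTE nsj) [i == s]eq_sym (negbTE nsi).
  move: (evec i) (evec j) (evec s) => x y z.
  by apply/matrixP => a b; rewrite !mxE; ring.
- rewrite (negbTE nrj) andbT.
  case: (eqVneq r i) => [->|nri] /=; rewrite !val_es /sym_tens.
    rewrite (negbTE nij) eqxx.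
    by move: (evec i) (evec j) => x y; apply/matrixP => a b; rewrite !mxE; ring.
  rewrite [j == r]eq_sym (negbTE nrj) [i == r]eq_sym (negbTE nri).
  move: (evec i) (evec j) (evec r) => x y z.
  by apply/matrixP => a b; rewrite !mxE; ring.
- by rewrite val_es.
Qed.

End SymmetricSquare.

Section Quantization.
Variables (F : fieldType) (m : nat).
Implicit Types (t q : F) (k : 'I_m).

Definition burau_diag t k : 'M[F]_m :=
  diag_mx (\row_i (if i == k then - t else 1)).

(* [ord_pred] and [ordS] are cyclic on 'I_m; they are only used below where
   they are the genuine predecessor and successor of k. *)
Definition burau t k : 'M[F]_m :=
  if (k == 0 :> nat) then
    burau_diag t k *m expE (-1) k (ordS k)
  else if k.+1 == m then
    expE 1 k (ord_pred k) *m burau_diag t k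
  else
    expE 1 k (ord_pred k) *m burau_diag t k *m expE (-1) k (ordS k).

Definition qdiag q k : 'End(sym2 F m) :=
  sym_ext (fun r s => (if (r == k) && (s == k) then q else 1) *: es F r s).

(* In the middle case D_k(q) is the rightmost factor, as it is for sigma_1.
   D_k(q) does not commute with [S^2(exp(-E_{k,k+1}))]_q, and with D_k(q) to
   the left of S^2(d_k) the braid relations fail as soon as m >= 3 and
   q <> 1. *)
Definition quant_S2_burau t q k : 'End(sym2 F m) :=
  if (k == 0 :> nat) then
    (S2 (burau_diag t k) \o qexpS2 q (-1) k (ordS k) \o qdiag q k)%VF
  else if k.+1 == m then
    (qexpS2 q 1 k (ord_pred k) \o qdiag q k \o S2 (burau_diag t k))%VF
  else
    (qexpS2 q 1 k (ord_pred k) \o S2 (burau_diag t k)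
       \o qexpS2 q (-1) k (ordS k) \o qdiag q k)%VF.

Lemma qdiag1 k : qdiag 1 k = \1%VF.
Proof.
by apply: sym2_ext => r s lrs; rewrite sym_extE // if_same scale1r id_lfunE.
Qed.

Lemma quant_S2_burau1 t k : (1 < m)%N ->
  quant_S2_burau t 1 k = S2 (burau t k).
Proof.
move=> m1; rewrite /quant_S2_burau /burau !qdiag1.
have nS : k.+1 != m -> k != ordS k.
  move=> km; have lt_km : (k.+1 < m)%N by rewrite ltn_neqAle km ltn_ord.
  by rewrite -val_eqE /= modn_small // neq_ltn ltnSn.
have nP : k != 0 :> nat -> k != ord_pred k.
  move=> k0; rewrite -val_eqE /=; case: k k0 {nS} => [[|k] lt_km] //= _.
  by rewrite modnDr modn_small ?(ltnW lt_km) // neq_ltn ltnSn orbT.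
have Nsq : (-1) ^+ 2 = 1 :> F by rewrite sqrrN expr1n.
case: (eqVneq (k : nat) 0%N) => [k0|k0].
  rewrite comp_lfun1r S2M qexpS2_1 // nS //.
  by rewrite k0 neq_ltn m1.
case: (eqVneq k.+1 m) => [km|km].
  by rewrite comp_lfun1r S2M qexpS2_1 ?nP ?expr1n.
by rewrite comp_lfun1r !S2M !qexpS2_1 ?nP ?nS ?expr1n.
Qed.

End Quantization.

Section Krammer.
Variables (F : fieldType) (n : nat).
Implicit Types (t q : F) (i j k : nat).

Definition krammer_index := {p : 'I_n * 'I_n | (p.1 < p.2)%N}.

Definition krammer_space : vectType F := {ffun krammer_index -> F^o}.

(* The basis vector F_{j,k} for j < k < n (and 0 for other j and k). *)
Definition krF j k : krammer_space :=
  [ffun p : krammer_index =>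
     (((val p).1 == j :> nat) && ((val p).2 == k :> nat))%:R : F^o].

Definition krammer_img t q i j k : krammer_space :=
  if [&& i.+1 != j, i != j, i.+1 != k & i != k] then krF j k
  else if i.+1 == j then
    t *: krF i k + (t * (t - 1)) *: krF i j + (1 - t) *: krF j k
  else if (i == j) && (i.+1 != k) then krF j.+1 k
  else if (i.+1 == k) && (i != j) then
    t *: krF j i + (1 - t) *: krF j k + (t * (t - 1) * q) *: krF i k
  else if i == k then krF j k.+1
  else (q * t ^+ 2) *: krF j k.

Definition krammer_fun t q i (v : krammer_space) : krammer_space :=
  \sum_(p : krammer_index)
    (v : {ffun krammer_index -> F^o}) p *: krammer_img t q i (val p).1 (val p).2.

Definition krammer t q (i : 'I_n.-1) : 'End(krammer_space) :=
  linfun (krammer_fun t q i).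

Lemma krammer_fun_is_linear t q i : linear (krammer_fun t q i).
Proof.
move=> a u v; rewrite /krammer_fun scaler_sumr -big_split /=.
by apply: eq_bigr => p _; rewrite !ffunE scalerDl scalerA.
Qed.

HB.instance Definition _ t q i := GRing.isLinear.Build F
  krammer_space krammer_space _ (krammer_fun t q i)
  (krammer_fun_is_linear t q i).

Lemma krammerE t q (i : 'I_n.-1) (j k : nat) : (j < k < n)%N ->
  krammer t q i (krF j k) = krammer_img t q i j k.
Proof.
move=> /andP[jk kn]; rewrite /krammer lfunE /= /krammer_fun.
pose p0 : krammer_index :=
  exist _ (Ordinal (ltn_trans jk kn), Ordinal kn) jk.
rewrite (bigD1 p0) //= ffunE /= !eqxx scale1r big1 ?addr0 // => p np.
rewrite ffunE; case: andP => [[/eqP e1 /eqP e2]|]; last by rewrite scale0r.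
case/eqP: np; apply/val_inj => /=; case: p e1 e2 => [[a b] ab] /= e1 e2.
by congr (_, _); apply/val_inj.
Qed.

End Krammer.

(* Main.v *)
From HB Require Import structures.
Require Import Defs.
From mathcomp Require Import all_boot all_order all_algebra.
From mathcomp Require Import complex reals.
From mathcomp Require Import mxtens zify ring.

(** Write [arc j l] for the vector e_j + ... + e_(l-1) of F^m.  The intertwiner
    is the correspondence F_{j,l} <-> arc j l (x) arc j l.

    It is read off from the generators: sigma_i multiplies F_{i,i+1} and
    e_i (x) e_i by q t^2, the Krammer operator sigma_l sends F_{j,l} to
    F_{j,l+1}, and quantized Burau sends the square of arc j l to the square of
    arc j (l+1).  Neither t nor q enters, so the correspondence does not
    degenerate for any value of the parameters.

    The squares of the arcs form a basis of S^2(F^m): since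
    arc r (s+1) = e_r + y + e_s with y = arc (r+1) s, for r < s one has
      (e_r + y + e_s)^2 - (e_r + y)^2 - (y + e_s)^2 + y^2
        = e_r (x) e_s + e_s (x) e_r
    ([es_square_arc]), and conversely the mixed differences of the F_{j,l}
    span the Krammer space by induction on l - j ([krF_limg]).  Hence
    e_rs |-> F_{r,s+1} - F_{r,s} - F_{r+1,s+1} + F_{r+1,s} ([diff_map]) and
    F_{j,l} |-> arc j l (x) arc j l ([arc_map]) are mutually inverse.

    For the intertwining property, the image under sigma_k of the square of any
    vector u has coordinates depending on u and on u_(k-1), u_k, u_(k+1) only,
    where out of range entries count as 0 ([quant_square_coord]).  On an arc
    these entries are 0 or 1, and the six cases of the Krammer action are the
    six positions of k relative to the ends of the arc
    ([quant_square_arc]). *)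

Set Implicit Arguments.
Unset Strict Implicit.
Unset Printing Implicit Defensive.

Import GRing.Theory.
Local Open Scope ring_scope.

(** * The quantized action in coordinates *)

Lemma neqF (T : eqType) (x y : T) :
  x != y -> ((x == y) = false) * ((y == x) = false).
Proof. by rewrite [y == x]eq_sym => /negbTE ->. Qed.

Section Coordinates.
Variables (F : fieldType) (m : nat).
Implicit Types (i j k r s : 'I_m) (v w : sym2 F m) (u x : 'cV[F]_m).

Lemma sym_coordP c v w r s :
  sym_coord (c *: v + w) r s = c * sym_coord v r s + sym_coord w r s.
Proof. by rewrite /sym_coord linearP !mxE. Qed.

Lemma sym_coordD v w r s :
  sym_coord (v + w) r s = sym_coord v r s + sym_coord w r s.
Proof. by rewrite /sym_coord linearD mxE. Qed.

Lemma sym_coordZ c v r s : sym_coord (c *: v) r s = c * sym_coord v r s.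
Proof. by rewrite /sym_coord linearZ mxE. Qed.

Lemma sym_coord_inj v w :
  (forall r s, sym_coord v r s = sym_coord w r s) -> v = w.
Proof.
move=> evw; rewrite [v]sym2E [w]sym2E.
by do 2!apply: eq_bigr => ? _; rewrite evw.
Qed.

(** Coordinate formulas for the operators, which are given by their values on
    the e^s_ij, are identities of linear forms and are checked on this basis. *)
Lemma scalar_es_ext (phi psi : sym2 F m -> F) : scalar phi -> scalar psi ->
  (forall i j, phi (es F i j) = psi (es F i j)) -> phi =1 psi.
Proof.
move=> phiL psiL eqes v.
pose Lphi := GRing.isLinear.Build _ _ _ _ phi phiL.
pose Lpsi := GRing.isLinear.Build _ _ _ _ psi psiL.
pose f : {linear _ -> F^o} := HB.pack phi Lphi.
pose g : {linear _ -> F^o} := HB.pack psi Lpsi.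
rewrite -[LHS]/(f v) -[RHS]/(g v) [v]sym2E !linear_sum.
apply: eq_bigr => i _; rewrite !linear_sum; apply: eq_bigr => j _.
by rewrite !linearZ /= eqes.
Qed.

(** The transpose of the action on the e^s_rs: only the coordinates with an
    index [i] change, as those with an index [j] flow into them. *)
Lemma qexpS2_coord q c i j v r s : i != j ->
  sym_coord (qexpS2 q c i j v) r s =
    if r == i then
      if s == i then
        sym_coord v i i + c * (1 + q) * sym_coord v i j + sym_coord v j j
      else sym_coord v i s + c * sym_coord v j s
    else if s == i then sym_coord v r i + c * sym_coord v r j
    else sym_coord v r s.
Proof.
move=> nij; move: v; apply: scalar_es_ext => [a v w|a v w|].
- by rewrite linearP sym_coordP.
- by case: (r == i); case: (s == i); rewrite !sym_coordP; ring.
move=> a b; wlog leab : a b / (a <= b)%N => [hw|].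
  by have [/hw //|/ltnW/hw] := leqP a b; rewrite esC.
rewrite sym_extE //.
have nji : (j == i) = false by rewrite eq_sym (negbTE nij).
have [-> | /neqF nai] := eqVneq a i; last have [-> | /neqF naj] := eqVneq a j;
 (have [-> | /neqF nbi] := eqVneq b i; last have [-> | /neqF nbj] := eqVneq b j);
 (have [-> | /neqF nri] := eqVneq r i; last have [-> | /neqF nrj] := eqVneq r j);
 (have [-> | /neqF nsi] := eqVneq s i; last have [-> | /neqF nsj] := eqVneq s j);
 rewrite ?eqxx ?nji ?(negbTE nij) ?nai ?naj ?nbi ?nbj ?nri ?nrj ?nsi ?nsj /=;
 rewrite ?(sym_coordD, sym_coordZ, sym_coord_es);
 rewrite ?eqxx ?nji ?(negbTE nij) ?nai ?naj ?nbi ?nbj ?nri ?nrj ?nsi ?nsj /=;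
 rewrite ?andbF ?orbF ?andbT ?orbb; rewrite /= ?mulr0n; ring.
Qed.

Lemma qdiag_coord q k v r s : sym_coord (qdiag q k v) r s =
  (if (r == k) && (s == k) then q else 1) * sym_coord v r s.
Proof.
move: v; apply: scalar_es_ext => [a v w|a v w|a b].
- by rewrite linearP sym_coordP.
- by rewrite sym_coordP; ring.
wlog leab : a b / (a <= b)%N => [hw|].
  by have [/hw //|/ltnW/hw] := leqP a b; rewrite esC.
rewrite sym_extE // sym_coordZ sym_coord_es.
have [/orP[] /andP[/eqP -> /eqP ->] // | _] := boolP (_ || _).
  by rewrite andbC.
by rewrite !mulr0.
Qed.

Lemma S2_diag_coord (d : 'rV[F]_m) v r s :
  sym_coord (S2 (diag_mx d) v) r s = d 0 r * d 0 s * sym_coord v r s.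
Proof.
rewrite {1}/sym_coord S2E mxE (bigD1 (mxtens_index (r, s))) //= big1 => [|k].
  by rewrite addr0 tensmxE !mxE !eqxx.
rewrite -[k]mxtens_unindexK; case: (mxtens_unindex k) => a b nab.
rewrite tensmxE !mxE.
have [era|] := eqVneq r a; last by rewrite !mul0r.
have [esb|] := eqVneq s b; last by rewrite mulr0 mul0r.
by rewrite era esb eqxx in nab.
Qed.

(** As u (x) u is symmetric, [vsproj] does not change it. *)
Definition square u : sym2 F m := vsproj (sym2_space F m) (u *t u).

Lemma square_coord u r s : sym_coord (square u) r s = u r 0 * u s 0.
Proof. by rewrite /sym_coord vsprojK ?tens_diag_mem // tens_coord. Qed.

(** Setting the missing neighbours to 0 gives the first and the last generators
    the same formula as the others. *)
Definition left_nbr u k : F := if k == 0 :> nat then 0 else u (ord_pred k) 0.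
Definition right_nbr u k : F := if k.+1 == m then 0 else u (ordS k) 0.

(** Off the (k,k) entry this is the square of the Burau image of [u], whose k-th
    entry is [z] and whose other entries are those of [u]; at q = 1 the (k,k)
    entry is [z ^+ 2] as well. *)
Lemma quant_square_coord t q k u r s : (1 < m)%N ->
  sym_coord (quant_S2_burau t q k (square u)) r s =
    let x := u k 0 in let l := left_nbr u k in let y := right_nbr u k in
    let z := l - t * x + t * y in
    if r == k then
      if s == k then
        l ^+ 2 - t * (1 + q) * l * (x - y)
          + t ^+ 2 * (q * x ^+ 2 - (1 + q) * x * y + y ^+ 2)
      else z * u s 0
    else if s == k then u r 0 * z
    else u r 0 * u s 0.
Proof.
move=> m_gt1; rewrite /quant_S2_burau /left_nbr /right_nbr /=.
have nS : k.+1 != m -> k != ordS k.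
  move=> km; have lt_km : (k.+1 < m)%N by rewrite ltn_neqAle km ltn_ord.
  by rewrite -val_eqE /= modn_small // neq_ltn ltnSn.
have nP : k != 0 :> nat -> k != ord_pred k.
  move=> k0; rewrite -val_eqE /=; case: k k0 {nS} => [[|k] lt_km] //= _.
  by rewrite modnDr modn_small ?(ltnW lt_km) // neq_ltn ltnSn orbT.
have diagE := S2_diag_coord (\row_i (if i == k then - t else 1)).
have {}diagE v a b : sym_coord (S2 (burau_diag t k) v) a b =
    (if a == k then - t else 1) * (if b == k then - t else 1)
      * sym_coord v a b by rewrite diagE !mxE.
have DE := qdiag_coord q k.
have expP := @qexpS2_coord q 1 k (ord_pred k).
have expS := @qexpS2_coord q (-1) k (ordS k).
(* Only the coordinate formulas of the factors matter from here on; with the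
   factors as variables, rewriting does not try to unfold them. *)
move: (S2 _) (qdiag q k) (qexpS2 q 1 _ _) (qexpS2 q (-1) _ _) diagE DE expP expS.
move=> d D eP eS dE DE ePE eSE.
case: (eqVneq (k : nat) 0%N) => [k0|/nP kP].
  have kS : k != ordS k by apply: nS; rewrite k0 neq_ltn m_gt1.
  have -> : k.+1 == m = false by rewrite k0 ltn_eqF.
  rewrite !comp_lfunE !dE !eSE // !DE !square_coord !eqxx !(neqF kS) /=.
  case: (eqVneq r k) => [?|_]; case: (eqVneq s k) => [?|_] //=; subst; ring.
have nkP := neqF kP.
have [km|/nS kS] := eqVneq k.+1 m.
  rewrite !comp_lfunE !ePE // !DE !dE !square_coord !eqxx !nkP /=.
  case: (eqVneq r k) => [?|_]; case: (eqVneq s k) => [?|_] //=; subst; ring.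
rewrite !comp_lfunE !ePE // !dE !eSE // !DE !square_coord.
rewrite !eqxx !nkP !(neqF kS) /=.
case: (eqVneq r k) => [?|_]; case: (eqVneq s k) => [?|_] //=; subst;
  rewrite ?eqxx ?nkP ?(neqF kS) /=; ring.
Qed.
End Coordinates.

(** * Squares of arcs *)

(** Replaces each indicator [nat_of_bool b] by its value, found by linear
    arithmetic or else by cases; the comparisons assumed in one case decide
    later indicators, so that only consistent configurations remain. *)
Ltac eval_bool := repeat match goal with |- context [nat_of_bool ?b] => first
  [ rewrite (_ : nat_of_bool b = 1%N); last by lia
  | rewrite (_ : nat_of_bool b = 0%N); last by lia
  | let E := fresh in case: (boolP b) => E;
    [rewrite (_ : nat_of_bool true = 1%N); last by []
    |rewrite (_ : nat_of_bool false = 0%N); last by []] ] end.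

Section Arcs.
Variables (F : fieldType) (m : nat).
Implicit Types (a b : nat) (k r s : 'I_m).

Definition arc a b : 'cV[F]_m := \col_r ((a <= r < b)%N)%:R.

Lemma arcE a b r : arc a b r 0 = ((a <= r < b)%N)%:R.
Proof. by rewrite mxE. Qed.

Lemma left_nbr_arc a b k : left_nbr (arc a b) k = ((a < k <= b)%N)%:R.
Proof.
rewrite /left_nbr; case: eqVneq => [-> //|k0]; rewrite arcE.
suff -> : (ord_pred k = k.-1 :> nat)%N by congr (nat_of_bool _)%:R; lia.
case: k k0 => [[|k] lt_km] //= _.
by rewrite modnDr modn_small ?(ltnW lt_km).
Qed.

Lemma right_nbr_arc a b k : (b <= m)%N ->
  right_nbr (arc a b) k = ((a <= k.+1 < b)%N)%:R.
Proof.
move=> le_bm; rewrite /right_nbr; case: eqVneq => [-> |km].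
  by rewrite (leq_gtF le_bm) andbF.
by rewrite arcE /= modn_small // ltn_neqAle km ltn_ord.
Qed.

Lemma square_arc0 a b : (b <= a)%N -> square (arc a b) = 0.
Proof.
move=> leba; apply: sym_coord_inj => r s; rewrite square_coord !arcE.
have -> : (a <= r < b)%N = false by lia.
by rewrite mul0r /sym_coord linear0 mxE.
Qed.

(** Polarization by inclusion-exclusion.  For [r = s] the last three arcs are
    empty, and the first is e_r. *)
Lemma es_square_arc r s : (r <= s)%N -> es F r s =
  square (arc r s.+1) - square (arc r s)
    - square (arc r.+1 s.+1) + square (arc r.+1 s).
Proof.
move=> ler; apply: sym_coord_inj => a b.
rewrite sym_coordD -!scaleN1r !(sym_coordD, sym_coordZ) !square_coord.
rewrite sym_coord_es !arcE -!val_eqE /=.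
eval_bool; ring.
Qed.
End Arcs.

(** * The two linear maps and the intertwining relation *)

Section Intertwiner.
Variables (F : fieldType) (n : nat).
Local Notation m := n.-1.

Definition arc_map_fun (v : krammer_space F n) : sym2 F m :=
  \sum_(p : krammer_index n)
    (v : {ffun krammer_index n -> F^o}) p
      *: square (arc F m (val p).1 (val p).2).

Lemma arc_map_fun_is_linear : linear arc_map_fun.
Proof.
move=> a u v; rewrite /arc_map_fun scaler_sumr -big_split /=.
by apply: eq_bigr => p _; rewrite !ffunE scalerDl scalerA.
Qed.

HB.instance Definition _ := GRing.isLinear.Build F _ _ _
  arc_map_fun arc_map_fun_is_linear.

Definition arc_map : 'Hom(krammer_space F n, sym2 F m) := linfun arc_map_fun.

Lemma arc_map_krF j l : (j < l < n)%N ->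
  arc_map (krF F n j l) = square (arc F m j l).
Proof.
move=> /andP[jl ln]; rewrite /arc_map lfunE /= /arc_map_fun.
pose p0 : krammer_index n :=
  exist _ (Ordinal (ltn_trans jl ln), Ordinal ln) jl.
rewrite (bigD1 p0) //= ffunE /= !eqxx scale1r big1 ?addr0 // => p np.
rewrite ffunE; case: andP => [[/eqP e1 /eqP e2]|]; last by rewrite scale0r.
case/eqP: np; apply/val_inj => /=; case: p e1 e2 => [[a b] ab] /= e1 e2.
by congr (_, _); apply/val_inj.
Qed.

(** The braid generator sees an arc only through its entries at k-1, k, k+1:
    they are constant when k is away from both ends, and each of the remaining
    Krammer cases is one way for an end of the arc to meet them. *)
Lemma quant_square_arc t q (k : 'I_m) j l : (2 < n)%N -> (j < l < n)%N ->
  quant_S2_burau t q k (square (arc F m j l)) =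
    arc_map (krammer_img n t q k j l).
Proof.
move=> n_gt2 jln; have m_gt1 : (1 < m)%N by lia.
have lm : (l <= m)%N by lia.
have km := ltn_ord k.
have offk (r : 'I_m) : r != k -> (r : nat) != k by rewrite val_eqE.
rewrite /krammer_img.
do ![case: ifP => ?]; rewrite ?linearD ?linearZ /= !arc_map_krF; try lia;
apply: sym_coord_inj => r s;
rewrite quant_square_coord //= left_nbr_arc right_nbr_arc //;
rewrite !(sym_coordD, sym_coordZ, square_coord, arcE);
(have [-> | /offk nrk] := eqVneq r k; have [-> | /offk nsk] := eqVneq s k);
eval_bool; ring.
Qed.

Lemma krF0 j l : (l <= j)%N -> krF F n j l = 0.
Proof.
move=> lj; apply/ffunP => -[[a b] /= ab]; rewrite !ffunE /=.
by case: andP => // -[/eqP aj /eqP bl]; lia.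
Qed.

Lemma krammer_spaceE (v : krammer_space F n) :
  v = \sum_(p : krammer_index n)
    (v : {ffun krammer_index n -> F^o}) p *: krF F n (val p).1 (val p).2.
Proof.
apply/ffunP => p; rewrite sum_ffunE (bigD1 p) //= big1 ?addr0 => [|p' np].
  by rewrite !ffunE !eqxx /GRing.scale /= mulr1.
rewrite !ffunE; case: andP => [[/eqP e1 /eqP e2]|]; last by rewrite scaler0.
case/eqP: np; apply/val_inj => /=.
rewrite [LHS]surjective_pairing [RHS]surjective_pairing.
by congr (_, _); apply/val_inj.
Qed.

(** Mirrors [es_square_arc], which makes [diff_map] a right inverse of
    [arc_map]. *)
Definition krF_diff r s : krammer_space F n :=
  krF F n r s.+1 - krF F n r s - krF F n r.+1 s.+1 + krF F n r.+1 s.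

Definition diff_map_fun (v : sym2 F m) : krammer_space F n :=
  \sum_(r < m) \sum_(s < m | (r <= s)%N) sym_coord v r s *: krF_diff r s.

Lemma diff_map_fun_is_linear : linear diff_map_fun.
Proof.
move=> a u v; rewrite /diff_map_fun scaler_sumr -big_split /=.
apply: eq_bigr => r _; rewrite scaler_sumr -big_split /=.
by apply: eq_bigr => s _; rewrite sym_coordP scalerDl scalerA.
Qed.

HB.instance Definition _ := GRing.isLinear.Build F _ _ _
  diff_map_fun diff_map_fun_is_linear.

Definition diff_map : 'Hom(sym2 F m, krammer_space F n) := linfun diff_map_fun.

Lemma diff_map_es (r s : 'I_m) : (r <= s)%N ->
  diff_map (es F r s) = krF_diff r s.
Proof.
move=> ler; rewrite /diff_map lfunE /= /diff_map_fun.
rewrite -[RHS](sym_pick (fun r s : 'I_m => krF_diff r s) ler).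
by do 2!apply: eq_bigr => ? _; rewrite sym_coord_es.
Qed.

Lemma diff_mapK : cancel diff_map arc_map.
Proof.
move=> v; suff /lfunP/(_ v) : (arc_map \o diff_map)%VF = \1%VF.
  by rewrite comp_lfunE id_lfunE.
have krE j l : (l < n)%N -> arc_map (krF F n j l) = square (arc F m j l).
  move=> ln; have [jl|lj] := ltnP j l; first by rewrite arc_map_krF ?jl.
  by rewrite krF0 // square_arc0 // linear0.
apply: sym2_ext => r s ler; rewrite comp_lfunE id_lfunE diff_map_es //.
have sn : (s.+1 < n)%N by have := ltn_ord s; lia.
by rewrite es_square_arc // linearD !linearB /= !krE // ltnW.
Qed.

(** Solving [krF_diff j s] for its longest term F_{j,s+1} leaves terms of
    smaller length, so these triangular relations can be inverted. *)
Lemma krF_limg j l : (l < n)%N -> krF F n j l \in limg diff_map.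
Proof.
have [d] := ubnP (l - j); elim: d j l => // d IHd j l lt_d ln.
have [lj|jl] := leqP l j; first by rewrite krF0 ?mem0v.
case: l => // s in lt_d ln jl *.
have [jm sm] : (j < m)%N /\ (s < m)%N by lia.
have -> : krF F n j s.+1 = diff_map (es F (Ordinal jm) (Ordinal sm))
    + (krF F n j s + krF F n j.+1 s.+1 - krF F n j.+1 s).
  by rewrite diff_map_es //; apply/ffunP => p; rewrite !ffunE; ring.
rewrite memvD ?memv_img ?memvf //.
by rewrite rpredB ?rpredD ?IHd //; lia.
Qed.

Lemma limg_diff_map : limg diff_map = fullv.
Proof.
apply/vspaceP => w; rewrite memvf [w]krammer_spaceE.
by apply: memv_suml => p _; rewrite memvZ // krF_limg.
Qed.

Lemma arc_mapK : cancel arc_map diff_map.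
Proof.
move=> w; have : w \in limg diff_map by rewrite limg_diff_map memvf.
by case/memv_imgP => v _ ->; rewrite diff_mapK.
Qed.

Lemma lker_diff_map : lker diff_map = 0%VS.
Proof. by apply/eqP/lker0P; exact: can_inj diff_mapK. Qed.

Lemma diff_map_inv : (diff_map^-1)%VF = arc_map.
Proof.
apply/lfunP => w; rewrite -{1}[w]arc_mapK lker0_lfunK //.
by rewrite lker_diff_map.
Qed.

Lemma diff_map_conj t q (k : 'I_m) : (2 < n)%N ->
  (diff_map \o quant_S2_burau t q k \o diff_map^-1)%VF = krammer t q k.
Proof.
move=> n_gt2; rewrite diff_map_inv; apply/lfunP => w.
rewrite [w]krammer_spaceE !linear_sum; apply: eq_bigr => p _.
rewrite !linearZ /=; congr (_ *: _).
have pn : ((val p).1 < (val p).2 < n)%N by rewrite (valP p) ltn_ord.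
rewrite !comp_lfunE arc_map_krF // quant_square_arc // krammerE //.
exact: arc_mapK.
Qed.

End Intertwiner.

Theorem theorem2p2 (R : realType) (n : nat) (t q : R[i])
    (hn : (3 <= n)%N) (ht : t != 0) (hq : q != 0) :
  exists C : 'Hom(sym2 (R[i]) n.-1, krammer_space (R[i]) n),
    [/\ lker C = 0%VS, limg C = fullv &
        forall k : 'I_n.-1,
          (C \o quant_S2_burau t q k \o C^-1)%VF = krammer t q k].
Proof.
exists (diff_map R[i] n).
by split=> [||k]; rewrite ?lker_diff_map ?limg_diff_map ?diff_map_conj.
Qed.
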